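(* Let $a\in\mathbb{Z}_{\geq 1}$. For $m\in\mathbb{Z}_{\ge 2}$ and $0\le r\le m$ put $$f_{m,a}(r)=\frac{1}{(1+a)^r}\sum_{i=0}^{r}\binom{m}{i}a^i,\qquad r_a=r_a(m)=\Big\lfloor\frac{am-(a-1)}{2a+1}\Big\rfloor+1 .$$ Then $$\lim_{m\to\infty} f_{m,a}(r_a)\sqrt{m}\Big(\frac{1+a}{1+2a}\Big)^{m}=\frac{(1+a)^{1/2}(1+2a)}{a^{3/2}\sqrt{2\pi}},$$ and consequently $$\lim_{a\to\infty}\lim_{m\to\infty} f_{m,a}(r_a)\sqrt{m}\Big(\frac{1+a}{1+2a}\Big)^{m}=\sqrt{\frac{2}{\pi}} .$$ *)

(* Defs.v *)
From Stdlib Require Import Reals ZArith.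
From Coquelicot Require Import Coquelicot.
Open Scope R_scope.

(* [Binomial.C] is qualified because Coquelicot uses [C] for the complex
   numbers; it is the binomial coefficient for [i <= m], so [f m a r] is
   meaningful for [r <= m]. *)
Definition f (m a r : nat) : R :=
  / (1 + INR a) ^ r * sum_f_R0 (fun i => Binomial.C m i * INR a ^ i) r.

(* [Int_part] is the floor.  For [1 <= a] and [1 <= m] its argument is positive,
   so [Z.to_nat] loses nothing; moreover [r_ a m <= m] when [2 <= m]. *)
Definition r_ (a m : nat) : nat :=
  (Z.to_nat (Int_part ((INR a * INR m - (INR a - 1)) / (2 * INR a + 1))) + 1)%nat.

Definition scaled_f (a m : nat) : R :=
  f m a (r_ a m) * sqrt (INR m) * ((1 + INR a) / (1 + 2 * INR a)) ^ m.

(* Main.v *)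
Require Import Defs.
From Stdlib Require Import Reals ZArith Lra Lia.
From Coquelicot Require Import Coquelicot.
Open Scope R_scope.

(** Write [t i = C(m,i) a^i], [p = a/(1+2a)] and [r = r_a(m) = pm + O(1)].
    Summing [(i+1) t (i+1) = a (m-i) t i] over [i <= r], once as it stands and
    once weighted by [r - i], shows that the partial sum of the [t i] is
    [(1 + 1/a + o(1)) t r].  Since
    [t r (1+a)^-r ((1+a)/(1+2a))^m = C(m,r) p^r (1-p)^(m-r)], what remains is the
    local limit theorem for the binomial distribution at bounded distance from
    its mean, which follows from Stirling's formula; the constant in the latter
    is identified by Wallis' integrals. *)

(** * Wallis' integrals *)

Definition wallis (n : nat) : R := RInt (fun x => sin x ^ n) 0 (PI / 2).

Lemma ex_RInt_sin_pow (n : nat) (a b : R) : ex_RInt (fun x => sin x ^ n) a b.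
Proof.
  apply (@ex_RInt_continuous R_CompleteNormedModule); intros x _.
  apply (@ex_derive_continuous R_AbsRing R_NormedModule).
  auto_derive; auto.
Qed.

(** Integration by parts in antiderivative form: [- cos x * sin x ^ S n] vanishes at both ends of
    the interval, and [cos^2 = 1 - sin^2] turns its derivative into the combination of the two
    integrands. *)
Lemma wallis_rec (n : nat) :
  (INR n + 2) * wallis (S (S n)) = (INR n + 1) * wallis n.
Proof.
  assert (H : is_RInt (fun x => (INR n + 2) * sin x ^ S (S n)
                                - (INR n + 1) * sin x ^ n) 0 (PI / 2)
                (- cos (PI / 2) * sin (PI / 2) ^ S n - (- cos 0 * sin 0 ^ S n))).
  { apply (is_RInt_derive (fun x => - cos x * sin x ^ S n)).
    - intros x _. auto_derive; auto.
      simpl pred.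
      replace (match n with O => 1 | S _ => INR n + 1 end) with (INR n + 1)
        by (destruct n; simpl; ring).
      assert (Hc : cos x * cos x = 1 - sin x * sin x).
      { generalize (sin2_cos2 x); unfold Rsqr; lra. }
      simpl pow.
      transitivity (sin x * (sin x * sin x ^ n)
                    - (INR n + 1) * (cos x * cos x) * sin x ^ n).
      { ring. }
      rewrite Hc; ring.
    - intros x _. apply (@ex_derive_continuous R_AbsRing R_NormedModule).
      auto_derive; auto. }
  assert (H' : is_RInt (fun x => (INR n + 2) * sin x ^ S (S n)
                                 - (INR n + 1) * sin x ^ n) 0 (PI / 2)
                 ((INR n + 2) * wallis (S (S n)) - (INR n + 1) * wallis n)).
  { apply (@is_RInt_minus R_NormedModule);
      apply (@is_RInt_scal R_NormedModule);
      apply (@RInt_correct R_CompleteNormedModule), ex_RInt_sin_pow. }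
  apply (@is_RInt_unique R_CompleteNormedModule) in H.
  apply (@is_RInt_unique R_CompleteNormedModule) in H'.
  rewrite H in H'. rewrite cos_PI2, sin_0 in H'. simpl in H'. lra.
Qed.

Lemma wallis_0 : wallis 0 = PI / 2.
Proof.
  unfold wallis; simpl. rewrite RInt_const.
  unfold scal; simpl; unfold mult; simpl. lra.
Qed.

Lemma wallis_1 : wallis 1 = 1.
Proof.
  assert (H : is_RInt (fun x => sin x ^ 1) 0 (PI / 2) (- cos (PI / 2) - - cos 0)).
  { apply (is_RInt_derive (fun x => - cos x)).
    - intros x _. auto_derive; auto; ring.
    - intros x _. apply (@ex_derive_continuous R_AbsRing R_NormedModule).
      auto_derive; auto. }
  apply (@is_RInt_unique R_CompleteNormedModule) in H.
  unfold wallis. rewrite H, cos_PI2, cos_0. ring.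
Qed.

Lemma wallis_decr (n : nat) : wallis (S n) <= wallis n.
Proof.
  generalize PI_RGT_0; intros Hpi.
  apply RInt_le; try apply ex_RInt_sin_pow; [lra|].
  intros x Hx. simpl.
  assert (0 <= sin x) by (apply sin_ge_0; lra).
  generalize (SIN_bound x) (pow_le _ n H); intros. nra.
Qed.

(** This is [4^n] over the central binomial coefficient [C(2n,n)]; Wallis' integrals of both
    parities are expressed through it. *)
Definition central (n : nat) : R :=
  4 ^ n * INR (fact n) ^ 2 / INR (fact (2 * n)).

Lemma central_pos (n : nat) : 0 < central n.
Proof.
  unfold central. generalize (INR_fact_lt_0 n) (INR_fact_lt_0 (2 * n)); intros.
  apply Rdiv_lt_0_compat; auto.
  apply Rmult_lt_0_compat; apply pow_lt; lra.
Qed.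

Lemma central_S (n : nat) :
  central (S n) = central n * (2 * INR n + 2) / (2 * INR n + 1).
Proof.
  unfold central. replace (2 * S n)%nat with (S (S (2 * n))) by lia.
  rewrite !fact_simpl, !mult_INR, !S_INR, mult_INR. change (INR 2) with 2.
  generalize (INR_fact_neq_0 n) (INR_fact_neq_0 (2 * n)) (pos_INR n); intros.
  simpl pow. field. repeat split; lra.
Qed.

Lemma wallis_even_odd (n : nat) :
  wallis (2 * n) = PI / 2 / central n
  /\ wallis (S (2 * n)) = central n / (2 * INR n + 1).
Proof.
  induction n as [|n [IH1 IH2]].
  - simpl (2 * 0)%nat. rewrite wallis_0, wallis_1. unfold central; simpl. lra.
  - replace (2 * S n)%nat with (S (S (2 * n))) by lia.
    generalize (wallis_rec (2 * n)) (wallis_rec (S (2 * n))).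
    rewrite IH1, IH2, central_S, !S_INR, mult_INR. change (INR 2) with 2.
    generalize (central_pos n) (pos_INR n); intros Hc Hn H1 H2.
    split.
    + apply Rmult_eq_reg_l with (2 * INR n + 2); [|lra].
      rewrite H1. field. lra.
    + apply Rmult_eq_reg_l with (2 * INR n + 1 + 2); [|lra].
      rewrite H2. field. lra.
Qed.

(** Multiply the chain [wallis (2n+1) <= wallis (2n) <= wallis (2n-1)] by [central n]: the right
    inequality gives the lower bound, the left one the upper bound. *)
Lemma central_sqr_bounds (n : nat) : (1 <= n)%nat ->
  PI <= central n ^ 2 / INR n <= PI + PI / 2 * / INR n.
Proof.
  intros Hn. destruct n as [|n]; [lia|].
  destruct (wallis_even_odd n) as [_ H1].
  destruct (wallis_even_odd (S n)) as [H2 H3].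
  generalize (wallis_decr (2 * S n)) (wallis_decr (S (2 * n))).
  replace (S (S (2 * n))) with (2 * S n)%nat by lia.
  rewrite H1, H2, H3.
  assert (Hc : central n = central (S n) * (2 * INR n + 1) / (2 * INR n + 2)).
  { rewrite central_S. generalize (pos_INR n). intros; field; lra. }
  rewrite Hc, S_INR.
  generalize (central_pos (S n)) (pos_INR n) PI_RGT_0.
  set (c := central (S n)). set (x := INR n). clearbody c x.
  intros Hc0 Hx Hpi L1 L2.
  apply Rmult_le_compat_l with (r := c) in L1; [|lra].
  apply Rmult_le_compat_l with (r := c) in L2; [|lra].
  replace (c * (PI / 2 / c)) with (PI / 2) in L1, L2 by (field; lra).
  split.
  - replace (c ^ 2 / (x + 1))
      with (2 * (c * (c * (2 * x + 1) / (2 * x + 2) / (2 * x + 1)))) by (field; lra).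
    lra.
  - replace (c ^ 2 / (x + 1))
      with (c * (c / (2 * (x + 1) + 1)) * ((2 * x + 3) / (x + 1))) by (field; lra).
    replace (PI + PI / 2 * / (x + 1)) with (PI / 2 * ((2 * x + 3) / (x + 1)))
      by (field; lra).
    apply Rmult_le_compat_r; auto.
    apply Rlt_le, Rdiv_lt_0_compat; lra.
Qed.

Lemma is_lim_seq_inv_INR : is_lim_seq (fun n => / INR n) 0.
Proof.
  apply (is_lim_seq_inv INR p_infty); [apply is_lim_seq_INR | easy].
Qed.

Lemma central_sqr_lim : is_lim_seq (fun n => central n ^ 2 / INR n) PI.
Proof.
  apply is_lim_seq_le_le_loc with (fun _ => PI) (fun n => PI + PI / 2 * / INR n).
  - exists 1%nat. intros n Hn; apply central_sqr_bounds; auto.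
  - apply is_lim_seq_const.
  - replace (Finite PI) with (Finite (PI + PI / 2 * 0)) by (f_equal; ring).
    apply is_lim_seq_plus'; [apply is_lim_seq_const|].
    apply (is_lim_seq_scal_l _ (PI / 2) 0), is_lim_seq_inv_INR.
Qed.

(** * Stirling's formula *)

(** The mean value theorem on [[0, x]]; it reduces the bounds on [ln (1 + x)] to the sign of a
    rational function. *)
Lemma le_of_derive_nonneg (f g : R -> R) (x : R) :
  0 <= x -> f 0 = 0 ->
  (forall t, 0 <= t -> is_derive f t (g t)) -> (forall t, 0 <= t -> 0 <= g t) ->
  0 <= f x.
Proof.
  intros Hx Hf0 Hd Hg.
  destruct (MVT_gen f 0 x g) as [c [Hc E]].
  - intros t Ht. rewrite Rmin_left in Ht by lra. apply Hd; lra.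
  - intros t Ht. rewrite Rmin_left in Ht by lra.
    apply derivable_continuous_pt. exists (g t). apply is_derive_Reals, Hd; lra.
  - rewrite Rmin_left, Rmax_right in Hc by lra.
    generalize (Hg c (proj1 Hc)). nra.
Qed.

(** The midpoint rule for the convex function [1 / (1 + t)] on [[0, x]]; [ln_1p_upper] is the
    trapezoidal rule. *)
Lemma ln_1p_lower (x : R) : 0 <= x -> 2 * x / (2 + x) <= ln (1 + x).
Proof.
  intros Hx.
  enough (0 <= ln (1 + x) - 2 * x / (2 + x)) by lra.
  apply (le_of_derive_nonneg (fun x => ln (1 + x) - 2 * x / (2 + x))
           (fun t => t ^ 2 / ((1 + t) * (2 + t) ^ 2))); auto.
  - rewrite !Rplus_0_r, ln_1. field.
  - intros t Ht. auto_derive; [lra|]. field; lra.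
  - intros t Ht. apply Rdiv_le_0_compat; [apply pow2_ge_0|].
    apply Rmult_lt_0_compat; [lra|apply pow_lt; lra].
Qed.

Lemma ln_1p_upper (x : R) : 0 <= x -> ln (1 + x) <= x * (2 + x) / (2 * (1 + x)).
Proof.
  intros Hx.
  enough (0 <= x * (2 + x) / (2 * (1 + x)) - ln (1 + x)) by lra.
  apply (le_of_derive_nonneg (fun x => x * (2 + x) / (2 * (1 + x)) - ln (1 + x))
           (fun t => t ^ 2 / (2 * (1 + t) ^ 2))); auto.
  - rewrite !Rplus_0_r, ln_1. field.
  - intros t Ht. auto_derive; [lra|]. field; lra.
  - intros t Ht. apply Rdiv_le_0_compat; [apply pow2_ge_0|].
    apply Rmult_lt_0_compat; [lra|apply pow_lt; lra].
Qed.

Definition log_stirling (n : nat) : R :=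
  ln (INR (fact n)) + INR n - (INR n + 1 / 2) * ln (INR n).

(** The difference is [(n + 1/2) ln (1 + 1/n) - 1]. The midpoint bound makes it nonnegative; the
    trapezoidal bound makes it at most [1 / (4n(n+1))], written here in telescoping form. *)
Lemma log_stirling_step (n : nat) : (1 <= n)%nat ->
  0 <= log_stirling n - log_stirling (S n) <= / 4 * (/ INR n - / INR (S n)).
Proof.
  intros Hn. apply le_INR in Hn. simpl in Hn.
  unfold log_stirling.
  rewrite fact_simpl, mult_INR, ln_mult by (apply lt_0_INR; generalize (lt_O_fact n); lia).
  rewrite S_INR. set (x := INR n) in *.
  assert (E : ln (x + 1) = ln x + ln (1 + / x)).
  { rewrite <- ln_mult; [f_equal; field; lra | lra |].
    assert (0 < / x) by (apply Rinv_0_lt_compat; lra). lra. }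
  assert (Hi : 0 <= / x) by (apply Rlt_le, Rinv_0_lt_compat; lra).
  generalize (ln_1p_lower _ Hi) (ln_1p_upper _ Hi). intros L U.
  rewrite E. set (l := ln (1 + / x)) in *.
  replace (2 * / x / (2 + / x)) with (/ (x + 1 / 2)) in L by (field; lra).
  replace (/ x * (2 + / x) / (2 * (1 + / x)))
    with ((x + 1 / 2) / (x * (x + 1))) in U by (field; lra).
  apply Rmult_le_compat_l with (r := x + 1 / 2) in L; [|lra].
  apply Rmult_le_compat_l with (r := x + 1 / 2) in U; [|lra].
  rewrite Rinv_r in L by lra.
  replace ((x + 1 / 2) * ((x + 1 / 2) / (x * (x + 1))))
    with (1 + / 4 * (/ x - / (x + 1))) in U by (field; lra).
  split; lra.
Qed.

(** From index 1 on the sequence decreases while [log_stirling n - 1/(4n)] increases, which supplies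
    the lower bound. The shift by one avoids index 0, which the step estimate does not cover. *)
Lemma log_stirling_cv : exists l : R, is_lim_seq log_stirling l.
Proof.
  destruct (ex_finite_lim_seq_decr (fun n => log_stirling (S n))
              (log_stirling 1 - / 4)) as [l Hl].
  - intros n. generalize (log_stirling_step (S n)). intros H.
    assert (1 <= S n)%nat by lia. specialize (H H0). lra.
  - intros n.
    assert (H : log_stirling 1 - / 4 <= log_stirling (S n) - / 4 * / INR (S n)).
    { induction n as [|n IH].
      - simpl. rewrite Rinv_1. lra.
      - generalize (log_stirling_step (S n)). intros H.
        assert (1 <= S n)%nat by lia. specialize (H H0). lra. }
    assert (0 < / INR (S n)) by (apply Rinv_0_lt_compat, lt_0_INR; lia).
    lra.
  - exists l. now apply is_lim_seq_incr_1.
Qed.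

Definition stirling_ratio (n : nat) : R :=
  INR (fact n) / (sqrt (INR n) * (INR n / exp 1) ^ n).

Lemma exp_INR (n : nat) : exp (INR n) = exp 1 ^ n.
Proof.
  induction n as [|n IH]; [apply exp_0|].
  rewrite S_INR, exp_plus, IH. simpl. ring.
Qed.

Lemma stirling_ratio_exp (n : nat) : (1 <= n)%nat ->
  stirling_ratio n = exp (log_stirling n).
Proof.
  intros Hn. assert (H : 0 < INR n) by (apply lt_0_INR; lia).
  unfold log_stirling, stirling_ratio.
  generalize (INR_fact_lt_0 n) (exp_pos 1) (sqrt_lt_R0 _ H). intros Hf He Hs.
  unfold Rminus. rewrite !exp_plus, exp_Ropp, exp_ln by auto.
  rewrite Rmult_plus_distr_r, exp_plus, exp_INR.
  fold (Rpower (INR n) (INR n)). rewrite Rpower_pow by auto.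
  replace (exp (1 / 2 * ln (INR n))) with (sqrt (INR n)).
  - unfold Rdiv. rewrite Rpow_mult_distr, pow_inv.
    field. repeat split; try apply pow_nonzero; lra.
  - rewrite <- Rpower_sqrt by auto. unfold Rpower. f_equal. field.
Qed.

Lemma stirling_ratio_pos (n : nat) : (1 <= n)%nat -> 0 < stirling_ratio n.
Proof. intros Hn. rewrite stirling_ratio_exp by auto. apply exp_pos. Qed.

(** In this quotient the powers of [n] and [e] cancel and only the central binomial coefficient
    survives; this ties Stirling's constant to Wallis' limit. *)
Lemma stirling_ratio_double (n : nat) : (1 <= n)%nat ->
  (stirling_ratio n ^ 2 / stirling_ratio (2 * n)) ^ 2 = 2 * (central n ^ 2 / INR n).
Proof.
  intros Hn. assert (H : 0 < INR n) by (apply lt_0_INR; lia).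
  unfold stirling_ratio, central. rewrite mult_INR. change (INR 2) with 2.
  generalize (INR_fact_lt_0 n) (INR_fact_lt_0 (2 * n)) (exp_pos 1) (sqrt_lt_R0 _ H).
  intros Hf Hf2 He Hs.
  assert (H2 : 0 < 2 * INR n) by lra.
  generalize (sqrt_lt_R0 _ H2). intros Hs2.
  rewrite (pow_mult _ 2 n).
  replace ((2 * INR n / exp 1) ^ 2) with (4 * (INR n / exp 1) ^ 2) by (field; lra).
  rewrite Rpow_mult_distr.
  replace (((INR n / exp 1) ^ 2) ^ n) with (((INR n / exp 1) ^ n) ^ 2)
    by (rewrite <- !pow_mult; f_equal; lia).
  assert (0 < (INR n / exp 1) ^ n) by (apply pow_lt, Rdiv_lt_0_compat; auto).
  set (y := (INR n / exp 1) ^ n) in *.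
  assert (0 < 4 ^ n) by (apply pow_lt; lra).
  generalize (sqrt_sqrt (INR n)) (sqrt_sqrt (2 * INR n)). intros E1 E2.
  set (s := sqrt (INR n)) in *. set (s2 := sqrt (2 * INR n)) in *.
  transitivity ((s2 * s2) * (4 ^ n * INR (fact n) ^ 2 / INR (fact (2 * n))) ^ 2
                / ((s * s) * (s * s))).
  - field. repeat split; lra.
  - rewrite E1, E2 by lra. field. split; lra.
Qed.

(** The limit [L = exp l] exists and is positive. Passing to the limit in [stirling_ratio_double]
    gives [(L^2 / L)^2 = L^2] on one side and [2 * PI] on the other. *)
Lemma stirling : is_lim_seq stirling_ratio (sqrt (2 * PI)).
Proof.
  destruct log_stirling_cv as [l Hl].
  assert (H : is_lim_seq stirling_ratio (exp l)).
  { apply is_lim_seq_ext_loc with (fun n => exp (log_stirling n)).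
    - exists 1%nat. intros n Hn. now rewrite stirling_ratio_exp.
    - apply (is_lim_seq_continuous exp); auto.
      apply derivable_continuous_pt, derivable_pt_exp. }
  assert (Hd : is_lim_seq (fun n => stirling_ratio (2 * n)) (exp l)).
  { apply (is_lim_seq_subseq stirling_ratio); auto.
    apply eventually_subseq. intros n; lia. }
  generalize (exp_pos l) PI_RGT_0. intros Hp Hpi.
  assert (H2 : is_lim_seq (fun n => (stirling_ratio n ^ 2 / stirling_ratio (2 * n)) ^ 2)
                 (exp l ^ 2)).
  { replace (exp l ^ 2) with ((exp l * exp l / exp l) * (exp l * exp l / exp l))
      by (field; lra).
    apply is_lim_seq_ext with
      (fun n => (stirling_ratio n * stirling_ratio n / stirling_ratio (2 * n))
              * (stirling_ratio n * stirling_ratio n / stirling_ratio (2 * n))).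
    - intros n. unfold Rdiv. ring.
    - apply is_lim_seq_mult';
      apply is_lim_seq_div'; auto; try lra; apply is_lim_seq_mult'; auto. }
  assert (H3 : is_lim_seq (fun n => (stirling_ratio n ^ 2 / stirling_ratio (2 * n)) ^ 2)
                 (2 * PI)).
  { apply is_lim_seq_ext_loc with (fun n => 2 * (central n ^ 2 / INR n)).
    - exists 1%nat. intros n Hn. now rewrite stirling_ratio_double.
    - apply (is_lim_seq_scal_l _ 2 PI), central_sqr_lim. }
  apply is_lim_seq_unique in H2. apply is_lim_seq_unique in H3.
  rewrite H2 in H3. injection H3 as E.
  rewrite <- E. replace (exp l * (exp l * 1)) with (exp l * exp l) by ring.
  now rewrite sqrt_square by lra.
Qed.

(** * The local limit theorem *)

Lemma eventually_lt_INR (x : R) : eventually (fun n => x < INR n).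
Proof. exact (proj2 (is_lim_seq_spec INR p_infty) is_lim_seq_INR x). Qed.

(** Deviations of order 1 are far below the standard deviation, which is of order [sqrt m], so the
    Gaussian factor of the local limit theorem tends to 1. *)
Definition near_line (p K : R) (r : nat -> nat) : Prop :=
  eventually (fun m => Rabs (INR (r m) - p * INR m) <= K).

(** That [r m] tends to infinity allows limits such as Stirling's to be composed with [r]. *)
Lemma near_line_filterlim (p K : R) (r : nat -> nat) :
  0 < p -> near_line p K r -> filterlim r eventually eventually.
Proof.
  intros Hp Hr P [N HN]. unfold filtermap.
  (* Beyond this threshold [p * m - K > N], and [r m] is at least [p * m - K]. *)
  generalize (filter_and _ _ Hr (eventually_lt_INR ((INR N + K) / p))).
  apply filter_imp. intros m [H1 H2].
  apply HN, INR_le.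
  apply Rmult_lt_compat_r with (r := p) in H2; [|lra].
  unfold Rdiv in H2. rewrite Rmult_assoc, Rinv_l, Rmult_1_r in H2 by lra.
  apply Rabs_le_between in H1. lra.
Qed.

Lemma near_line_ratio (p K : R) (r : nat -> nat) :
  near_line p K r -> is_lim_seq (fun m => INR (r m) / INR m) p.
Proof.
  intros Hr.
  apply is_lim_seq_le_le_loc with (fun m => p + - K * / INR m) (fun m => p + K * / INR m).
  - generalize (filter_and _ _ Hr (eventually_lt_INR 0)).
    apply filter_imp. intros m [H1 H2].
    apply Rabs_le_between in H1.
    assert (Hi : 0 < / INR m) by now apply Rinv_0_lt_compat.
    replace (INR (r m) / INR m) with (p + (INR (r m) - p * INR m) * / INR m)
      by (field; lra).
    split; apply Rplus_le_compat_l, Rmult_le_compat_r; lra.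
  - replace (Finite p) with (Finite (p + - K * 0)) by (f_equal; ring).
    apply is_lim_seq_plus'; [apply is_lim_seq_const|].
    apply (is_lim_seq_scal_l _ (- K) 0), is_lim_seq_inv_INR.
  - replace (Finite p) with (Finite (p + K * 0)) by (f_equal; ring).
    apply is_lim_seq_plus'; [apply is_lim_seq_const|].
    apply (is_lim_seq_scal_l _ K 0), is_lim_seq_inv_INR.
Qed.

Lemma near_line_lt (p K : R) (r : nat -> nat) :
  p < 1 -> near_line p K r -> eventually (fun m => (r m < m)%nat).
Proof.
  intros Hp Hr.
  generalize (filter_and _ _ Hr (eventually_lt_INR (K / (1 - p)))).
  apply filter_imp. intros m [H1 H2].
  apply INR_lt.
  apply Rmult_lt_compat_r with (r := 1 - p) in H2; [|lra].
  unfold Rdiv in H2. rewrite Rmult_assoc, Rinv_l, Rmult_1_r in H2 by lra.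
  apply Rabs_le_between in H1. lra.
Qed.

Lemma near_line_compl (p K : R) (r : nat -> nat) :
  p < 1 -> near_line p K r -> near_line (1 - p) K (fun m => m - r m)%nat.
Proof.
  intros Hp Hr. unfold near_line.
  (* Once [r m < m], the truncated subtraction on [nat] agrees with the real one. *)
  generalize (filter_and _ _ Hr (near_line_lt _ _ _ Hp Hr)).
  apply filter_imp. intros m [H1 H2].
  rewrite minus_INR by lia.
  replace (INR m - INR (r m) - (1 - p) * INR m) with (- (INR (r m) - p * INR m)) by ring.
  now rewrite Rabs_Ropp.
Qed.

Lemma exp_le (x y : R) : x <= y -> exp x <= exp y.
Proof.
  intros [H| ->]; [now apply Rlt_le, exp_increasing | apply Rle_refl].
Qed.

(** This is [ln y <= y - 1], multiplied by [n] and exponentiated. *)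
Lemma pow_le_exp (y : R) (n : nat) : 0 < y -> y ^ n <= exp (INR n * (y - 1)).
Proof.
  intros Hy. rewrite <- Rpower_pow by auto. unfold Rpower.
  apply exp_le, Rmult_le_compat_l; [apply pos_INR|].
  rewrite <- (ln_exp (y - 1)). apply ln_le; auto.
  generalize (exp_ineq1_le (y - 1)). lra.
Qed.

(** For positive [r], [s] and [m = r + s], this is [exp (- m * KL)], where [KL] is the relative
    entropy of the frequencies [(r/m, s/m)] with respect to [(p, 1-p)]. *)
Definition entropy_factor (p : R) (r s : nat) : R :=
  (p * (INR r + INR s) / INR r) ^ r * ((1 - p) * (INR r + INR s) / INR s) ^ s.

(* Both bounds come from [y ^ n <= exp (n (y - 1))], the lower one applied to
   the inverse bases: to first order the two exponents cancel. *)
Lemma entropy_factor_bounds (p K : R) (r s : nat) :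
  0 < p < 1 -> (1 <= r)%nat -> (1 <= s)%nat ->
  Rabs (INR r - p * (INR r + INR s)) <= K ->
  exp (- (K ^ 2 / (p * (1 - p)) * / (INR r + INR s))) <= entropy_factor p r s <= 1.
Proof.
  intros Hp Hr Hs HK. unfold entropy_factor.
  apply (lt_0_INR r) in Hr. apply (lt_0_INR s) in Hs.
  set (x := INR r) in *. set (y := INR s) in *.
  set (A := p * (x + y) / x). set (B := (1 - p) * (x + y) / y).
  assert (HA : 0 < A) by (apply Rdiv_lt_0_compat; nra).
  assert (HB : 0 < B) by (apply Rdiv_lt_0_compat; nra).
  split.
  - assert (HA' : 0 < / A) by now apply Rinv_0_lt_compat.
    assert (HB' : 0 < / B) by now apply Rinv_0_lt_compat.
    generalize (pow_le_exp _ r HA') (pow_le_exp _ s HB'). intros LA LB.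
    rewrite pow_inv in LA, LB.
    apply (pow_lt _ r) in HA. apply (pow_lt _ s) in HB.
    apply Rinv_le_contravar in LA; [|now apply Rinv_0_lt_compat].
    apply Rinv_le_contravar in LB; [|now apply Rinv_0_lt_compat].
    rewrite Rinv_inv, <- exp_Ropp in LA, LB.
    apply Rle_trans with (exp (- (x * (/ A - 1))) * exp (- (y * (/ B - 1)))).
    + rewrite <- exp_plus. apply exp_le.
      (* The exponents add up to minus Pearson's chi-square statistic of the counts [x], [y]; the
         linear parts cancel. *)
      replace (- (x * (/ A - 1)) + - (y * (/ B - 1)))
        with (- ((x - p * (x + y)) ^ 2 / (p * (1 - p)) * / (x + y)))
        by (unfold A, B; field; repeat split; nra).
      apply Ropp_le_contravar, Rmult_le_compat_r.
      { apply Rlt_le, Rinv_0_lt_compat; lra. }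
      apply Rmult_le_compat_r.
      { apply Rlt_le, Rinv_0_lt_compat; nra. }
      rewrite <- (pow2_abs (x - _)). apply pow_incr. split; auto. apply Rabs_pos.
    + apply Rmult_le_compat; auto; apply Rlt_le, exp_pos.
  - generalize (pow_le_exp _ r HA) (pow_le_exp _ s HB). intros LA LB.
    apply Rle_trans with (exp (x * (A - 1)) * exp (y * (B - 1))).
    + apply Rmult_le_compat; auto; apply Rlt_le, pow_lt; auto.
    + rewrite <- exp_plus.
      (* Here the cancellation is exact: the summands are [p (x+y) - x] and [(1-p) (x+y) - y]. *)
      replace (x * (A - 1) + y * (B - 1)) with 0 by (unfold A, B; field; lra).
      rewrite exp_0. apply Rle_refl.
Qed.

Lemma entropy_factor_lim (p K : R) (r : nat -> nat) :
  0 < p < 1 -> near_line p K r ->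
  is_lim_seq (fun m => entropy_factor p (r m) (m - r m)) 1.
Proof.
  intros Hp Hr.
  apply is_lim_seq_le_le_loc with
    (fun m => exp (- (K ^ 2 / (p * (1 - p)) * / INR m))) (fun _ => 1).
  - generalize (filter_and _ _ Hr (filter_and _ _ (near_line_lt p K r (proj2 Hp) Hr)
      (near_line_filterlim p K r (proj1 Hp) Hr (fun n => 1 <= n)%nat
         (ex_intro _ 1%nat (fun n H => H))))).
    apply filter_imp. intros m [H1 [H2 H3]].
    assert (E : INR m = INR (r m) + INR (m - r m)).
    { rewrite <- plus_INR. f_equal. lia. }
    rewrite E. rewrite E in H1. apply entropy_factor_bounds; auto. lia.
  - replace (Finite 1) with (Finite (exp (- (K ^ 2 / (p * (1 - p)) * 0))))
      by now rewrite Rmult_0_r, Ropp_0, exp_0.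
    apply (is_lim_seq_continuous exp).
    + apply derivable_continuous_pt, derivable_pt_exp.
    + apply (is_lim_seq_opp _ (K ^ 2 / (p * (1 - p)) * 0)).
      apply (is_lim_seq_scal_l _ _ 0), is_lim_seq_inv_INR.
  - apply is_lim_seq_const.
Qed.

Lemma fact_stirling_ratio (n : nat) : (1 <= n)%nat ->
  INR (fact n) = stirling_ratio n * (sqrt (INR n) * (INR n / exp 1) ^ n).
Proof.
  intros Hn. unfold stirling_ratio.
  assert (H : 0 < INR n) by (apply lt_0_INR; lia).
  generalize (sqrt_lt_R0 _ H) (exp_pos 1). intros.
  field. split; try lra. apply pow_nonzero, Rgt_not_eq, Rdiv_lt_0_compat; lra.
Qed.

(** Writing the three factorials through [stirling_ratio] makes the powers of [e] cancel; the square
    roots form the normalising factor and the remaining powers form [entropy_factor]. *)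
Lemma binomial_pmf_stirling (p : R) (r s : nat) :
  0 < p < 1 -> (1 <= r)%nat -> (1 <= s)%nat ->
  sqrt (INR (r + s)) * (Binomial.C (r + s) r * p ^ r * (1 - p) ^ s)
  = stirling_ratio (r + s) / (stirling_ratio r * stirling_ratio s)
    * / (sqrt (INR r / INR (r + s)) * sqrt (INR s / INR (r + s)))
    * entropy_factor p r s.
Proof.
  intros Hp Hr Hs. unfold Binomial.C, entropy_factor.
  replace (r + s - r)%nat with s by lia.
  rewrite <- plus_INR.
  rewrite (fact_stirling_ratio r), (fact_stirling_ratio s), (fact_stirling_ratio (r + s))
    by lia.
  assert (Hm : 0 < INR (r + s)) by (apply lt_0_INR; lia).
  generalize (stirling_ratio_pos r Hr) (stirling_ratio_pos s Hs). intros Pr Ps.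
  apply (lt_0_INR r) in Hr. apply (lt_0_INR s) in Hs.
  rewrite !sqrt_div_alt by auto.
  generalize (sqrt_lt_R0 _ Hm) (sqrt_lt_R0 _ Hr) (sqrt_lt_R0 _ Hs) (exp_pos 1).
  intros Qm Qr Qs He.
  unfold Rdiv. rewrite !Rpow_mult_distr, !pow_inv, !pow_add.
  generalize (pow_lt _ r He) (pow_lt _ s He) (pow_lt _ r Hr) (pow_lt _ s Hs). intros.
  field. repeat split; lra.
Qed.

(** In the factorisation [binomial_pmf_stirling] the Stirling quotient tends to [1 / sqrt (2 * PI)],
    the frequencies tend to [p] and [1 - p], and the entropy factor tends to 1. *)
Lemma local_limit (p K : R) (r : nat -> nat) :
  0 < p < 1 -> near_line p K r ->
  is_lim_seq
    (fun m => sqrt (INR m) * (Binomial.C m (r m) * p ^ r m * (1 - p) ^ (m - r m)))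
    (/ (sqrt (2 * PI) * (sqrt p * sqrt (1 - p)))).
Proof.
  intros Hp Hr.
  assert (Hs := near_line_compl _ _ _ (proj2 Hp) Hr).
  assert (Fr := near_line_filterlim _ _ _ (proj1 Hp) Hr).
  assert (Fs := near_line_filterlim _ _ _ (proj1 (Rminus_lt_0 _ _) (proj2 Hp)) Hs).
  generalize PI_RGT_0. intros Hpi.
  assert (Q : 0 < sqrt (2 * PI)) by (apply sqrt_lt_R0; lra).
  assert (Qp : 0 < sqrt p) by (apply sqrt_lt_R0; lra).
  assert (Qq : 0 < sqrt (1 - p)) by (apply sqrt_lt_R0; lra).
  apply is_lim_seq_ext_loc with (fun m =>
    stirling_ratio m / (stirling_ratio (r m) * stirling_ratio (m - r m))
    * / (sqrt (INR (r m) / INR m) * sqrt (INR (m - r m) / INR m))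
    * entropy_factor p (r m) (m - r m)).
  - generalize (filter_and _ _ (near_line_lt p K r (proj2 Hp) Hr)
      (Fr (fun n => 1 <= n)%nat (ex_intro _ 1%nat (fun n H => H)))).
    apply filter_imp. intros m [H1 H2].
    assert (H3 : (1 <= m - r m)%nat) by lia.
    generalize (binomial_pmf_stirling p (r m) (m - r m) Hp H2 H3).
    now replace (r m + (m - r m))%nat with m by lia.
  - replace (/ (sqrt (2 * PI) * (sqrt p * sqrt (1 - p))))
      with (sqrt (2 * PI) / (sqrt (2 * PI) * sqrt (2 * PI))
            * / (sqrt p * sqrt (1 - p)) * 1) by (field; repeat split; lra).
    apply is_lim_seq_mult'; [apply is_lim_seq_mult'|].
    + apply is_lim_seq_div'.
      * apply stirling.
      * apply is_lim_seq_mult'; apply (is_lim_seq_subseq stirling_ratio); auto using stirling.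
      * apply Rgt_not_eq; nra.
    + apply (is_lim_seq_inv _ (sqrt p * sqrt (1 - p))).
      * apply is_lim_seq_mult'; apply (is_lim_seq_continuous sqrt);
          try (apply continuity_pt_sqrt; lra).
        -- now apply near_line_ratio with K.
        -- now apply (near_line_ratio (1 - p) K (fun m => m - r m)%nat).
      * intros E. injection E. nra.
    + now apply entropy_factor_lim with K.
Qed.

(** * Partial binomial sums *)

Definition binomial_term (m : nat) (a : R) (i : nat) : R := Binomial.C m i * a ^ i.

Lemma binomial_term_pos (m : nat) (a : R) (i : nat) : 0 < a -> 0 < binomial_term m a i.
Proof.
  intros Ha. unfold binomial_term, Binomial.C.
  apply Rmult_lt_0_compat; [|now apply pow_lt].
  apply Rdiv_lt_0_compat; [|apply Rmult_lt_0_compat]; apply INR_fact_lt_0.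
Qed.

Lemma binomial_term_S (m : nat) (a : R) (i : nat) : (i < m)%nat ->
  INR (S i) * binomial_term m a (S i) = a * (INR m - INR i) * binomial_term m a i.
Proof.
  intros Hi. unfold binomial_term. rewrite pascal_step3 by auto.
  rewrite minus_INR by lia. simpl pow. field. apply not_0_INR; lia.
Qed.

(** By [binomial_term_S] the summand is [(i+1) t (i+1) - i t i] for [i < m], so the sum
    telescopes. *)
Lemma binomial_drift_sum (m : nat) (a : R) (r : nat) : (r <= m)%nat ->
  sum_f_R0 (fun i => (a * INR m - (a + 1) * INR i) * binomial_term m a i) r
  = a * (INR m - INR r) * binomial_term m a r.
Proof.
  induction r as [|r IH]; intros Hr.
  - simpl. ring.
  - rewrite tech5, IH, <- binomial_term_S by lia. ring.
Qed.

(** Summation by parts: the weight [r - i] adds up the partial drift sums with upper index [j < r],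
    each equal to [(j+1) t (j+1)]. *)
Lemma binomial_drift_moment (m : nat) (a : R) (r : nat) : (r <= m)%nat ->
  sum_f_R0 (fun i => (a * INR m - (a + 1) * INR i)
                     * ((INR r - INR i) * binomial_term m a i)) r
  = sum_f_R0 (fun i => INR i * binomial_term m a i) r.
Proof.
  induction r as [|r IH]; intros Hr.
  - simpl. ring.
  - rewrite (tech5 (fun i => INR i * _)), <- IH by lia.
    rewrite binomial_term_S, <- binomial_drift_sum, <- plus_sum, tech5 by lia.
    (* The new top term carries weight zero; every other weight has grown by one, which accounts for
       the added drift sum. *)
    rewrite Rminus_diag, Rmult_0_l, Rmult_0_r, Rplus_0_r.
    apply sum_eq. intros i _. rewrite S_INR. ring.
Qed.

Definition head_ratio (m : nat) (a : R) (r : nat) : R :=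
  sum_f_R0 (binomial_term m a) r / binomial_term m a r.

(** The drift at [i] is [D + (a+1)(r-i)], so the drift sum reads [D U + (a+1) V = a (m-r) t r], and
    [V >= 0] yields the upper bound. As the drift is at least [D] for [i <= r], the moment identity
    gives [D V <= r U]; with the upper bound on [U] this bounds [V], hence [U] from below. *)
Lemma head_ratio_bounds (m : nat) (a : R) (r : nat) :
  0 < a -> (r <= m)%nat -> let D := a * INR m - (a + 1) * INR r in 0 < D ->
  a * (INR m - INR r) / D - (a + 1) * INR r * (a * (INR m - INR r)) / D ^ 3
  <= head_ratio m a r <= a * (INR m - INR r) / D.
Proof.
  intros Ha Hr D HD.
  assert (Ht := fun i => binomial_term_pos m a i Ha).
  set (t := binomial_term m a) in *.
  set (U := sum_f_R0 t r).
  set (V := sum_f_R0 (fun i => (INR r - INR i) * t i) r).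
  assert (Hir : forall i, (i <= r)%nat -> 0 <= INR i <= INR r).
  { intros i Hi. split; [apply pos_INR | now apply le_INR]. }
  assert (HV : 0 <= V).
  { replace 0 with (sum_f_R0 (fun _ => 0) r) by (rewrite sum_cte; ring).
    apply sum_Rle. intros i Hi. specialize (Hir i Hi). specialize (Ht i). nra. }
  assert (E1 : D * U + (a + 1) * V = a * (INR m - INR r) * t r).
  { unfold t, U, V. rewrite <- binomial_drift_sum by auto.
    rewrite !scal_sum, <- plus_sum. apply sum_eq. intros i _.
    unfold D. fold t. ring. }
  assert (E2 : D * V <= INR r * U).
  { unfold U, V. rewrite !scal_sum.
    apply Rle_trans with (sum_f_R0 (fun i => INR i * t i) r).
    - unfold t. rewrite <- binomial_drift_moment by auto. fold t.
      apply sum_Rle. intros i Hi. specialize (Hir i Hi). specialize (Ht i).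
      rewrite Rmult_comm. apply Rmult_le_compat_r; [|unfold D]; nra.
    - apply sum_Rle. intros i Hi. specialize (Hir i Hi). specialize (Ht i). nra. }
  specialize (Ht r). unfold head_ratio. fold t. fold U.
  set (x := a * (INR m - INR r)) in *.
  assert (Hrr := pos_INR r).
  assert (HU : U / t r <= x / D).
  { apply Rle_div_l; auto. apply Rmult_le_reg_l with D; auto.
    replace (D * (x / D * t r)) with (x * t r) by (field; lra). nra. }
  split; auto.
  assert (HU' : U <= x / D * t r) by (apply Rle_div_l; auto).
  assert (HV' : V <= INR r * (x / D * t r) / D).
  { apply Rle_div_r; auto. nra. }
  apply Rle_div_r; auto. apply Rmult_le_reg_l with D; auto.
  replace (D * ((x / D - (a + 1) * INR r * x / D ^ 3) * t r))
    with (x * t r - (a + 1) * (INR r * (x / D * t r) / D)) by (field; lra).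
  nra.
Qed.

(** After scaling by [m], the two bounds of [head_ratio_bounds] differ by [O(1/m)]. The condition
    [0 < a - (a+1) p] keeps the index below the mode of the terms, at a distance linear in [m]. *)
Lemma head_ratio_lim (a : R) (r : nat -> nat) (p : R) :
  0 < a -> 0 < p < 1 -> 0 < a - (a + 1) * p ->
  is_lim_seq (fun m => INR (r m) / INR m) p ->
  is_lim_seq (fun m => head_ratio m a (r m)) (a * (1 - p) / (a - (a + 1) * p)).
Proof.
  intros Ha Hp HD Hr.
  set (d := fun m => a - (a + 1) * (INR (r m) / INR m)).
  set (x := fun m => a * (1 - INR (r m) / INR m)).
  assert (Ld : is_lim_seq d (a - (a + 1) * p)).
  { apply is_lim_seq_minus'; [apply is_lim_seq_const|].
    now apply (is_lim_seq_scal_l _ (a + 1) p). }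
  assert (Lx : is_lim_seq x (a * (1 - p))).
  { apply (is_lim_seq_scal_l _ a (1 - p)).
    apply is_lim_seq_minus'; [apply is_lim_seq_const|auto]. }
  assert (Lq : is_lim_seq (fun m => x m / d m) (a * (1 - p) / (a - (a + 1) * p))).
  { apply is_lim_seq_div'; auto; lra. }
  apply is_lim_seq_le_le_loc with
    (fun m => x m / d m
       - (a + 1) * (INR (r m) / INR m) * x m / (d m * d m * d m) * / INR m)
    (fun m => x m / d m); auto.
  - assert (E1 : eventually (fun m => 0 < d m)).
    (* The tolerance is the limit itself, which forces [d m] to be positive. *)
    { apply is_lim_seq_spec in Ld. destruct (Ld (mkposreal _ HD)) as [N HN].
      exists N. intros n Hn. specialize (HN n Hn). simpl in HN.
      apply Rabs_lt_between in HN. lra. }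
    generalize (filter_and _ _ E1 (eventually_lt_INR 0)).
    apply filter_imp. intros m [H1 H2].
    assert (Em : a * INR m - (a + 1) * INR (r m) = d m * INR m)
      by (unfold d; field; lra).
    assert (Ex : a * (INR m - INR (r m)) = x m * INR m) by (unfold x; field; lra).
    assert (HD' : 0 < d m * INR m) by nra.
    (* Positive drift means [(a+1) r < a m], hence [r < m]. *)
    assert (Hrm : (r m <= m)%nat).
    { apply INR_le. generalize (pos_INR (r m)). nra. }
    generalize (head_ratio_bounds m a (r m) Ha Hrm). cbv zeta.
    rewrite Em, Ex. intros H. specialize (H HD').
    replace (x m * INR m / (d m * INR m)) with (x m / d m) in H by (field; lra).
    replace ((a + 1) * (INR (r m) / INR m) * x m / (d m * d m * d m) * / INR m)
      with ((a + 1) * INR (r m) * (x m * INR m) / (d m * INR m) ^ 3) by (field; lra).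
    exact H.
  - replace (a * (1 - p) / (a - (a + 1) * p)) with
      (a * (1 - p) / (a - (a + 1) * p)
       - (a + 1) * p * (a * (1 - p)) / ((a - (a + 1) * p) * (a - (a + 1) * p)
            * (a - (a + 1) * p)) * 0) by (field; lra).
    apply is_lim_seq_minus'; auto.
    apply is_lim_seq_mult'; [|apply is_lim_seq_inv_INR].
    apply is_lim_seq_div'.
    + apply is_lim_seq_mult'; auto. now apply (is_lim_seq_scal_l _ (a + 1) p).
    + repeat apply is_lim_seq_mult'; auto.
    + apply Rgt_not_eq. repeat apply Rmult_lt_0_compat; auto.
Qed.

(** * The index [r_ a m] and the two limits *)

(** With [x] the argument of the floor, [r_ a m] lies in [(x, x+1]], while [p m] exceeds [x] by
    [(a-1)/(2a+1)], a number in [[0, 1]]; hence the constant 1. *)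
Lemma r_near_line (a : nat) : (1 <= a)%nat ->
  near_line (INR a / (1 + 2 * INR a)) 1 (r_ a).
Proof.
  intros Ha. exists 1%nat. intros m Hm. unfold r_.
  apply le_INR in Ha. apply le_INR in Hm. change (INR 1) with 1 in *.
  set (x := (INR a * INR m - (INR a - 1)) / (2 * INR a + 1)).
  assert (Hx : 0 < x) by (apply Rdiv_lt_0_compat; nra).
  generalize (base_Int_part x). intros [H1 H2].
  assert (Hz : (0 <= Int_part x)%Z).
  { assert (IZR (-1) < IZR (Int_part x)) by (simpl; lra).
    apply lt_IZR in H. lia. }
  rewrite plus_INR, INR_IZR_INZ, Z2Nat.id by auto. change (INR 1) with 1.
  replace (INR a / (1 + 2 * INR a) * INR m) with (x + (INR a - 1) / (2 * INR a + 1))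
    by (unfold x; field; lra).
  assert (H3 : 0 <= (INR a - 1) / (2 * INR a + 1)) by (apply Rdiv_le_0_compat; lra).
  assert (H4 : (INR a - 1) / (2 * INR a + 1) <= 1) by (apply Rle_div_l; lra).
  apply Rabs_le_between. lra.
Qed.

Lemma scaled_f_split (a m : nat) : (1 <= a)%nat -> (r_ a m <= m)%nat ->
  let p := INR a / (1 + 2 * INR a) in
  scaled_f a m
  = sqrt (INR m) * (Binomial.C m (r_ a m) * p ^ r_ a m * (1 - p) ^ (m - r_ a m))
    * head_ratio m (INR a) (r_ a m).
Proof.
  intros Ha Hr p. apply (lt_0_INR a) in Ha.
  unfold scaled_f, Defs.f, head_ratio.
  change (fun i => Binomial.C m i * INR a ^ i) with (binomial_term m (INR a)).
  generalize (binomial_term_pos m (INR a) (r_ a m) Ha).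
  set (U := sum_f_R0 (binomial_term m (INR a)) (r_ a m)). clearbody U.
  unfold binomial_term. generalize dependent (r_ a m). intros r Hr Ht.
  replace ((1 + INR a) / (1 + 2 * INR a)) with (1 - p) by (unfold p; field; lra).
  replace m with (r + (m - r))%nat at 2 by lia.
  rewrite pow_add.
  (* Both [(1-p) a] and [p (1+a)] equal [a (1+a) / (1+2a)]; this converts the weight [a^r / (1+a)^r]
     into the binomial one. *)
  assert (Hq : (1 - p) ^ r * INR a ^ r = p ^ r * (1 + INR a) ^ r).
  { rewrite <- !Rpow_mult_distr. f_equal. unfold p. field. lra. }
  generalize (pow_lt _ r Ha). intros Hpa.
  assert (0 < (1 + INR a) ^ r) by (apply pow_lt; lra).
  replace ((1 - p) ^ r) with (p ^ r * (1 + INR a) ^ r / INR a ^ r)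
    by (apply Rmult_eq_reg_r with (INR a ^ r); [rewrite Hq; field|]; lra).
  assert (Binomial.C m r <> 0) by (intros E; rewrite E in Ht; lra).
  field. repeat split; auto; lra.
Qed.

(** Spelled as in the theorem, so that its first half follows from [scaled_f_lim] by conversion. *)
Definition limit_value (x : R) : R :=
  Rpower (1 + x) (1 / 2) * (1 + 2 * x) / (Rpower x (3 / 2) * sqrt (2 * PI)).

Lemma Rpower_half (x : R) : 0 < x -> Rpower x (1 / 2) = sqrt x.
Proof. intros Hx. rewrite <- Rpower_sqrt by auto. f_equal. field. Qed.

Lemma Rpower_three_halves (x : R) : 0 < x -> Rpower x (3 / 2) = x * sqrt x.
Proof.
  intros Hx. replace (3 / 2) with (1 + 1 / 2) by field.
  now rewrite Rpower_plus, Rpower_1, Rpower_half.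
Qed.

Lemma scaled_f_lim (a : nat) : (1 <= a)%nat ->
  is_lim_seq (scaled_f a) (limit_value (INR a)).
Proof.
  intros Ha. set (p := INR a / (1 + 2 * INR a)).
  assert (Hr := r_near_line a Ha). fold p in Hr.
  assert (H := lt_0_INR a Ha).
  assert (Hp : 0 < p < 1).
  { split; [apply Rdiv_lt_0_compat | apply Rlt_div_l]; lra. }
  (* Since [(1 + 2a) p = a]; the limit of [head_ratio] is thus [(1-p)/p = 1 + 1/a]. *)
  assert (HD : INR a - (INR a + 1) * p = INR a * p) by (unfold p; field; lra).
  generalize PI_RGT_0. intros Hpi.
  apply is_lim_seq_ext_loc with (fun m =>
    sqrt (INR m) * (Binomial.C m (r_ a m) * p ^ r_ a m * (1 - p) ^ (m - r_ a m))
    * head_ratio m (INR a) (r_ a m)).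
  - generalize (near_line_lt _ _ _ (proj2 Hp) Hr). apply filter_imp. intros m Hm.
    symmetry. apply scaled_f_split; auto. lia.
  - replace (limit_value (INR a)) with
      (/ (sqrt (2 * PI) * (sqrt p * sqrt (1 - p)))
       * (INR a * (1 - p) / (INR a - (INR a + 1) * p))).
    + apply is_lim_seq_mult'.
      * now apply local_limit with 1.
      * apply head_ratio_lim; auto.
        -- rewrite HD. nra.
        -- now apply near_line_ratio with 1.
    + rewrite HD. unfold limit_value.
      rewrite Rpower_half, Rpower_three_halves by lra.
      replace (1 - p) with ((1 + INR a) / (1 + 2 * INR a)) by (unfold p; field; lra).
      unfold p. rewrite !sqrt_div_alt by lra.
      assert (S1 : 0 < sqrt (2 * PI)) by (apply sqrt_lt_R0; lra).
      assert (S2 : 0 < sqrt (INR a)) by (apply sqrt_lt_R0; lra).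
      assert (S3 : 0 < sqrt (1 + INR a)) by (apply sqrt_lt_R0; lra).
      assert (S4 : 0 < sqrt (1 + 2 * INR a)) by (apply sqrt_lt_R0; lra).
      assert (E3 := sqrt_sqrt (1 + INR a)). assert (E4 := sqrt_sqrt (1 + 2 * INR a)).
      transitivity ((sqrt (1 + 2 * INR a) * sqrt (1 + 2 * INR a)) * (1 + INR a)
                    / (sqrt (2 * PI) * sqrt (INR a) * sqrt (1 + INR a) * INR a)).
      { field. repeat split; lra. }
      rewrite E4 by lra. rewrite <- E3 at 1 by lra.
      field. repeat split; lra.
Qed.

(** Dividing numerator and denominator by [a^(3/2)] leaves continuous functions of [1/a], with limit
    [2 / sqrt (2 * PI)]. *)
Lemma limit_value_lim : is_lim_seq (fun a => limit_value (INR a)) (sqrt (2 / PI)).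
Proof.
  generalize PI_RGT_0. intros Hpi.
  assert (S1 : 0 < sqrt (2 * PI)) by (apply sqrt_lt_R0; lra).
  apply is_lim_seq_ext_loc with
    (fun a => sqrt (1 + / INR a) * (2 + / INR a) / sqrt (2 * PI)).
  - exists 1%nat. intros a Ha. assert (H := lt_0_INR a Ha).
    unfold limit_value. rewrite Rpower_half, Rpower_three_halves by lra.
    replace (1 + / INR a) with ((1 + INR a) / INR a) by (field; lra).
    rewrite sqrt_div_alt by lra.
    assert (S2 : 0 < sqrt (INR a)) by (apply sqrt_lt_R0; lra).
    field. repeat split; lra.
  - replace (sqrt (2 / PI)) with (sqrt (1 + 0) * (2 + 0) / sqrt (2 * PI)).
    + apply is_lim_seq_div'; [|apply is_lim_seq_const|lra].
      apply is_lim_seq_mult'.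
      * apply (is_lim_seq_continuous sqrt); [apply continuity_pt_sqrt; lra|].
        apply is_lim_seq_plus'; [apply is_lim_seq_const | apply is_lim_seq_inv_INR].
      * apply is_lim_seq_plus'; [apply is_lim_seq_const | apply is_lim_seq_inv_INR].
    + rewrite !Rplus_0_r, sqrt_1.
      replace (2 / PI) with (2 * 2 / (2 * PI)) by (field; lra).
      rewrite sqrt_div_alt, sqrt_square by lra. field. lra.
Qed.

Theorem theorem1p1 :
  (forall a : nat, (1 <= a)%nat ->
     is_lim_seq (fun m : nat => scaled_f a m)
       (Finite (Rpower (1 + INR a) (1 / 2) * (1 + 2 * INR a)
                / (Rpower (INR a) (3 / 2) * sqrt (2 * PI)))))
  /\
  is_lim_seq (fun a : nat => real (Lim_seq (fun m : nat => scaled_f a m)))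
    (Finite (sqrt (2 / PI))).
Proof.
  split; [exact scaled_f_lim|].
  apply is_lim_seq_ext_loc with (fun a => limit_value (INR a)); [|exact limit_value_lim].
  (* The outer limit disregards [a = 0]; for [a >= 1] the proved convergence identifies the value of
     the total function [Lim_seq]. *)
  exists 1%nat. intros a Ha.
  symmetry. exact (f_equal real (is_lim_seq_unique _ _ (scaled_f_lim a Ha))).
Qed.
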